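(* Let $(P,\mu^P),(Q,\mu^Q)\in\mathfrak{M}_n$ be two weighted point clouds, and for $R\in O(n)$ let $$E(R)=\int_{S^{n-1}}\ \min_{\sigma\in\mathrm{ADM}(\mu^P_{\theta,R},\mu^Q_\theta)}\ \sum_{i,j}\sigma_{ij}\big(p_iR\theta^T-q_j\theta^T\big)^2\ \mathrm{d}\theta .$$ Let $\{R^k\}_{k=1}^\infty$ be a sequence generated by the iterative algorithm described in the context. Then $E(R^{k+1})\le E(R^k)$ for every $k\ge1$.
   Context: Points of $\mathbb{R}^n$ are row vectors, $O(n)=\{R\in\mathbb{R}^{n\times n}: RR^T=I_n\}$, and $S^{n-1}$ is the unit sphere in $\mathbb{R}^n$ (of row vectors $\theta$) with its standard surface measure $\mathrm{d}\theta$ (counting measure on $\{\pm1\}$ if $n=1$). The space of weighted point clouds is $$\mathfrak{M}_n=\bigcup_{\ell=1}^{\infty}\Big\{(P,\mu)=\{(p_i,\mu_i)\in\mathbb{R}^n\times\mathbb{R}_+\}_{i=1}^{\ell}\ :\ \sum_{i=1}^{\ell}\mu_i=1,\ p_i\ne p_j\text{ if }i\ne j\Big\},$$ where $\mathbb{R}_+$ denotes the strictly positive reals; $\ell_P,\ell_Q$ are the numbers of points of $P,Q$. For $\theta\in S^{n-1}$ and $R\in O(n)$, let $\mu^P_{\theta,R}=\sum_i\mu^P_i\delta_{p_iR\theta^T}$ and $\mu^Q_\theta=\sum_j\mu^Q_j\delta_{q_j\theta^T}$ be the probability measures on $\mathbb{R}$ induced by the projections $p_i\mapsto p_iR\theta^T$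 and $q_j\mapsto q_j\theta^T$. A transport plan in $\mathrm{ADM}(\mu^P_{\theta,R},\mu^Q_\theta)$ is represented by a nonnegative matrix $\sigma\in\mathbb{R}^{\ell_P\times\ell_Q}$ with $\sum_j\sigma_{ij}=\mu^P_i$ and $\sum_i\sigma_{ij}=\mu^Q_j$. Algorithm: start from an initial $R^0\in O(n)$ and an initial family of transport plans $\sigma^0(\theta)$, $\theta\in S^{n-1}$. For $k=1,2,\dots$: (a) let $R^k\in\arg\min_{R\in O(n)}\int_{S^{n-1}}\sum_{i,j}\sigma^{k-1}_{ij}(\theta)\big(p_iR\theta^T-q_j\theta^T\big)^2\,\mathrm{d}\theta$; (b) for each $\theta\in S^{n-1}$, let $\sigma^k(\theta)\in\arg\min_{\sigma\in\mathrm{ADM}(\mu^P_{\theta,R^k},\mu^Q_\theta)}\sum_{i,j}\sigma_{ij}\big(p_iR^k\theta^T-q_j\theta^T\big)^2$. The plans $\sigma^k(\theta)$ are taken to depend measurably on $\theta$, so that the integrals make sense. *)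

(* Defs.v *)
From HB Require Import structures.
From mathcomp Require Import all_boot all_order all_algebra.
From mathcomp Require Import all_classical all_reals all_analysis.
From mathcomp Require Import measurable_realfun.
Import Order.TTheory GRing.Theory Num.Theory.
Import numFieldNormedType.Exports.

Set Implicit Arguments.
Unset Strict Implicit.
Unset Printing Implicit Defensive.

Local Open Scope classical_set_scope.
Local Open Scope ring_scope.

(* The product sigma-algebra on matrices: the one algorithm_run by the entries. *)
Definition measure_matrix_display : measure_display -> measure_display.
Proof. exact. Qed.

Section measurable_matrix.
Context {d} {T : measurableType d} (m n : nat).

Definition mx_cylinders : set (set 'M[T]_(m, n)) :=
  [set B | exists i j, exists2 A : set T,
    measurable A & B = [set M : 'M[T]_(m, n) | A (M i j)]].

Let mx_set0 : <<s mx_cylinders >> set0.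
Proof. exact: sigma_algebra0. Qed.

Let mx_setC A : <<s mx_cylinders >> A -> <<s mx_cylinders >> (~` A).
Proof. exact: sigma_algebraC. Qed.

Let mx_bigcup (F : (set 'M[T]_(m, n))^nat) :
  (forall i, <<s mx_cylinders >> (F i)) -> <<s mx_cylinders >> (\bigcup_i F i).
Proof. exact: sigma_algebra_bigcup. Qed.

HB.instance Definition _ := @isMeasurable.Build (measure_matrix_display d)
  'M[T]_(m, n) <<s mx_cylinders >> mx_set0 mx_setC mx_bigcup.

Lemma measurable_entry (i : 'I_m) (j : 'I_n) :
  measurable_fun [set: 'M[T]_(m, n)] (fun M : 'M[T]_(m, n) => M i j).
Proof.
move=> _ A mA; rewrite setTI; apply: sub_sigma_algebra.
by exists i, j, A.
Qed.

Lemma measurable_fun_mx d' (X : measurableType d') (D : set X)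
    (f : X -> 'M[T]_(m, n)) :
  (forall i j, measurable_fun D (fun x => f x i j)) -> measurable_fun D f.
Proof.
move=> mf mD; suff : measurable_fun D f by exact.
apply: (@measurability _ _ _ _ _ _ mx_cylinders) => //.
by move=> _ [_ [i [j [A mA ->]]] <-]; exact: mf.
Qed.

End measurable_matrix.

Section lebesgue_rV.
Context (R : realType).

Definition rV_cons n (p : measurableTypeR R * 'rV[R]_n) : 'rV[R]_n.+1 :=
  row_mx p.1%:M p.2 : 'rV[R]_(1 + n).

Definition rV_uncons n (x : 'rV[R]_n.+1) : measurableTypeR R * 'rV[R]_n :=
  (x 0 0, rsubmx (x : 'rV[R]_(1 + n))).

Lemma rV_consE0 n p : @rV_cons n p 0 0 = p.1.
Proof.
have -> : 0 = lshift n 0 :> 'I_(1 + n) by exact/val_inj.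
by rewrite /rV_cons (@row_mxEl _ 1 1 n) mxE eqxx.
Qed.

Lemma rV_consES n p j : @rV_cons n p 0 (lift ord0 j) = p.2 0 j.
Proof.
have -> : lift ord0 j = rshift 1 j :> 'I_(1 + n) by exact/val_inj.
by rewrite /rV_cons (@row_mxEr _ 1 1 n).
Qed.

Lemma rV_consK n : cancel (@rV_cons n) (@rV_uncons n).
Proof.
move=> p; rewrite /rV_uncons rV_consE0 /rV_cons row_mxKr.
by case: p.
Qed.

Lemma measurable_rV_cons n : measurable_fun setT (@rV_cons n).
Proof.
apply: measurable_fun_mx => i j; rewrite ord1.
case: (unliftP ord0 j) => [k ->|->].
  under eq_fun do rewrite rV_consES.
  exact: (measurableT_comp (measurable_entry 0 k) measurable_snd).
by under eq_fun do rewrite rV_consE0; exact: measurable_fst.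
Qed.

Lemma measurable_rV_uncons n : measurable_fun setT (@rV_uncons n).
Proof.
apply: measurable_fun_pair; first exact: measurable_entry.
apply: measurable_fun_mx => i j.
under eq_fun do rewrite mxE.
exact: measurable_entry.
Qed.

Section cons_measure.
Variables (n : nat) (mu : {sigma_finite_measure set 'rV[R]_n -> \bar R}).

Definition cons_measure : set 'rV[R]_n.+1 -> \bar R :=
  pushforward (lebesgue_measure \x mu)%E (@rV_cons n).

Let cons_measure0 : cons_measure set0 = 0%E.
Proof. by rewrite /cons_measure /pushforward preimage_set0 measure0. Qed.

Let cons_measure_ge0 A : (0 <= cons_measure A)%E.
Proof. by apply: integral_ge0 => x _; exact: measure_ge0. Qed.

Let cons_measure_sigma_additive : semi_sigma_additive cons_measure.
Proof.
move=> F mF tF mUF; rewrite /cons_measure /pushforward preimage_bigcup.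
have mpre A : measurable A -> measurable (@rV_cons n @^-1` A).
  by move=> mA; rewrite -[X in measurable X]setTI; exact: measurable_rV_cons.
apply: measure_semi_sigma_additive.
- by move=> k; exact: mpre.
- apply/trivIsetP => /= i j _ _ ij; rewrite -preimage_setI.
  by move/trivIsetP : tF => /(_ _ _ _ _ ij) ->//; rewrite preimage_set0.
- by rewrite -preimage_bigcup; exact: mpre.
Qed.

HB.instance Definition _ := isMeasure.Build _ _ _ cons_measure
  cons_measure0 cons_measure_ge0 cons_measure_sigma_additive.

Let cons_measure_sigma_finite : sigma_finite setT cons_measure.
Proof.
have /sigma_finiteP[F [TF ndF Foo]] := sigma_finiteT (@lebesgue_measure R).
have /sigma_finiteP[G [TG ndG Goo]] := sigma_finiteT mu.
exists (fun k => @rV_uncons n @^-1` (F k `*` G k)).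
  apply/seteqP; split => // x _.
  have [i _ Fi] : (\bigcup_i F i) (rV_uncons x).1 by rewrite -TF.
  have [j _ Gj] : (\bigcup_j G j) (rV_uncons x).2 by rewrite -TG.
  exists (maxn i j) => //; split => /=.
  - by move: Fi; exact/subsetPset/ndF/leq_maxl.
  - by move: Gj; exact/subsetPset/ndG/leq_maxr.
move=> k; have [mF Fk] := Foo k; have [mG Gk] := Goo k; split.
  rewrite -[X in measurable X]setTI; apply: measurable_rV_uncons => //.
  exact: measurableX.
rewrite /cons_measure /pushforward -comp_preimage.
rewrite (_ : @rV_uncons n \o _ = id); last by apply/funext/rV_consK.
rewrite preimage_id product_measure1E//.
by rewrite lte_mul_pinfty// ge0_fin_numE.
Qed.

HB.instance Definition _ :=
  Measure_isSigmaFinite.Build _ _ _ cons_measure cons_measure_sigma_finite.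

End cons_measure.

Fixpoint lebesgue_rV n : {sigma_finite_measure set 'rV[R]_n -> \bar R} :=
  if n is n'.+1 return {sigma_finite_measure set 'rV[R]_n -> \bar R} then
    cons_measure (lebesgue_rV n')
  else dirac (0 : 'rV[R]_0).

Lemma lebesgue_rV_box n (A : 'I_n -> set R) : (forall i, measurable (A i)) ->
  lebesgue_rV n [set x | forall i, A i (x 0 i)] =
  (\prod_(i < n) lebesgue_measure (A i))%E.
Proof.
elim: n A => [|n IHn] A mA.
  rewrite big_ord0 /= diracE mem_set//=.
  by case.
rewrite big_ord_recl -IHn//= /cons_measure /pushforward.
pose B := [set x : 'rV[R]_n | forall i, A (lift ord0 i) (x 0 i)].
have mB : measurable B.
  have -> : B = \big[setI/setT]_(i < n)
      ((fun x : 'rV[R]_n => x 0 i) @^-1` A (lift ord0 i)).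
    rewrite -bigcap_seq; apply/seteqP; split => [x /= Ax i _|x /= Ax i].
      exact: Ax.
    exact: (Ax i (mem_index_enum _)).
  apply: bigsetI_measurable => i _.
  by rewrite -[X in measurable X]setTI; exact: measurable_entry.
rewrite -product_measure1E//; last exact: mA.
apply: (congr1 (lebesgue_measure \x lebesgue_rV n)%E).
apply/seteqP; split => [p /= Ap|p /= [A0 Ap] i].
  split; first by have := Ap ord0; rewrite rV_consE0.
  by move=> i; have := Ap (lift ord0 i); rewrite rV_consES.
by case: (unliftP ord0 i) => [k ->|->]; rewrite ?rV_consE0 ?rV_consES//; apply: Ap.
Qed.

End lebesgue_rV.

Section sphere.
Context (R : realType) (n : nat).
Implicit Types (x theta : 'rV[R]_n) (A : set 'rV[R]_n).

(* The Euclidean norm; [`|x|] is the sup norm in the library. *)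
Definition enorm x : R := Num.sqrt ((x *m x^T) 0 0).

Definition sphere : set 'rV[R]_n := [set theta | enorm theta = 1].

Definition solid_cone A : set 'rV[R]_n :=
  [set r *: theta | r in `]0, 1]%classic & theta in sphere `&` A].

(* The surface measure in polar coordinates: n times the volume of the cone
   over [A] in the punctured unit ball. For n = 1 it gives mass 1 to each of the
   two points of the sphere (see [surface_measure1]). *)
Definition surface_measure A : \bar R :=
  (n%:R%:E * lebesgue_rV R n (solid_cone A))%E.

Lemma enorm_ge0 x : 0 <= enorm x.
Proof. exact: sqrtr_ge0. Qed.

Lemma enormE x : enorm x = Num.sqrt (\sum_i x 0 i ^+ 2).
Proof. by rewrite /enorm mxE; under eq_bigr do rewrite mxE -expr2. Qed.

Lemma enormZ r x : 0 <= r -> enorm (r *: x) = r * enorm x.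
Proof.
move=> r0; rewrite !enormE.
under eq_bigr do rewrite mxE exprMn.
by rewrite -mulr_sumr sqrtrM ?sqr_ge0// sqrtr_sqr ger0_norm.
Qed.

Lemma coneE A : solid_cone A =
  [set x | 0 < enorm x <= 1] `&` (fun x => (enorm x)^-1 *: x) @^-1` A.
Proof.
apply/seteqP; split => [x [r /=]|x /= [/andP[x0 x1] Ax]].
  rewrite in_itv/= => /andP[r0 r1] [theta [S1 Atheta] <-].
  rewrite enormZ ?(ltW r0)// S1 mulr1 scalerA mulVf ?gt_eqF// scale1r.
  by rewrite r0 r1.
exists (enorm x); first by rewrite /= in_itv/= x0 x1.
exists ((enorm x)^-1 *: x); last by rewrite scalerA divff ?gt_eqF// scale1r.
split => //; rewrite /sphere/= enormZ ?invr_ge0 ?enorm_ge0//.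
by rewrite mulVf// gt_eqF.
Qed.

Lemma measurable_enorm : measurable_fun setT enorm.
Proof.
rewrite (_ : enorm = Num.sqrt \o (fun x => \sum_i x 0 i ^+ 2)); last first.
  by apply/funext => x; rewrite enormE.
apply: measurableT_comp.
  by apply: continuous_measurable_fun; exact: sqrt_continuous.
apply: measurable_sum => i; exact: (measurable_funX 2%N (measurable_entry 0 i)).
Qed.

Lemma measurable_sphere : measurable sphere.
Proof.
by rewrite -[sphere]setTI; exact: (measurable_enorm measurableT (measurable_set1 1)).
Qed.

Lemma measurable_normalize :
  measurable_fun setT (fun x => (enorm x)^-1 *: x).
Proof.
apply: measurable_fun_mx => i j; rewrite ord1.
under eq_fun do rewrite mxE -powR_inv1 ?enorm_ge0//.
apply: measurable_funM; last exact: measurable_entry.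
exact: (measurableT_comp (@measurable_powR R (-1)) measurable_enorm).
Qed.

Lemma measurable_cone A : measurable A -> measurable (solid_cone A).
Proof.
move=> mA; rewrite coneE; apply: measurableI; last first.
  by rewrite -[X in measurable X]setTI; exact: measurable_normalize.
rewrite (_ : [set x | _] = enorm @^-1` `]0, 1]%classic); last first.
  by apply/seteqP; split => x /=; rewrite in_itv.
by rewrite -[X in measurable X]setTI; exact: measurable_enorm.
Qed.

Let surface_measure0 : surface_measure set0 = 0%E.
Proof. by rewrite /surface_measure coneE preimage_set0 setI0 measure0 mule0. Qed.

Let surface_measure_ge0 A : (0 <= surface_measure A)%E.
Proof. by rewrite /surface_measure mule_ge0// lee_fin. Qed.

Let surface_measure_sigma_additive : semi_sigma_additive surface_measure.
Proof.
move=> F mF tF mUF.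
have cup : solid_cone (\bigcup_k F k) = \bigcup_k solid_cone (F k).
  rewrite coneE preimage_bigcup setI_bigcupr.
  by apply: eq_bigcupr => k _; rewrite coneE.
rewrite /surface_measure cup.
under eq_fun do rewrite -ge0_sume_distrr//.
apply: cvgeZl => //; apply: measure_semi_sigma_additive.
- by move=> k; exact: measurable_cone.
- apply/trivIsetP => /= i j _ _ ij; rewrite !coneE setIACA -preimage_setI.
  by move/trivIsetP : tF => /(_ _ _ _ _ ij) ->//; rewrite preimage_set0 setI0.
- by rewrite -cup; exact: measurable_cone.
Qed.

HB.instance Definition _ := isMeasure.Build _ _ _ surface_measure
  surface_measure0 surface_measure_ge0 surface_measure_sigma_additive.

End sphere.
Arguments sphere {R n}.
Arguments surface_measure {R n}.

Lemma surface_measure1 (R : realType) (e : 'rV[R]_1) :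
  sphere e -> surface_measure [set e] = 1%E.
Proof.
move=> Se.
have sq : e 0 0 ^+ 2 = 1.
  have := Se; rewrite /sphere/= enormE big_ord1 sqrtr_sqr => e1.
  by rewrite -[LHS]real_normK ?num_real// e1 expr1n.
pose I : set R := if e 0 0 == 1 then `]0, 1]%classic else `[-1, 0[%classic.
have IE r : I (r * e 0 0) <-> 0 < r <= 1.
  move/eqP: sq; rewrite sqrf_eq1 /I => /orP[|] /eqP ->.
    by rewrite eqxx mulr1/= in_itv.
  by rewrite eqNr oner_eq0/= in_itv/= mulrN1 oppr_lt0 lerN2 andbC.
have II : lebesgue_measure I = 1%E.
  rewrite /I; case: ifP => _; rewrite lebesgue_measure_itv/=.
    by rewrite lte_fin ltr01 oppr0 adde0.
  by rewrite lte_fin ltrN10 opprK add0e.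
have mI : measurable I by rewrite /I; case: ifP.
rewrite /surface_measure mul1e (_ : solid_cone _ = [set x | forall i, I (x 0 i)]).
  by rewrite (lebesgue_rV_box (fun=> mI)) big_ord1.
have eN0 : e 0 0 != 0 by rewrite -sqrf_eq0 sq oner_eq0.
apply/seteqP; split => [x [r /= r01 [_ [_ ->] <-]] i|x /= Ix].
  by rewrite ord1 mxE; apply/IE; move: r01; rewrite in_itv.
have xE : x = (x 0 0 / e 0 0) *: e.
  by apply/rowP => i; rewrite ord1 mxE divfK.
exists (x 0 0 / e 0 0); last by exists e.
by rewrite /= in_itv/=; apply/IE; rewrite divfK.
Qed.

Definition orthogonal_group (R : realType) (n : nat) : set 'M[R]_n :=
  [set U | U *m U^T = 1%:M].
Arguments orthogonal_group {R n}.

Definition argmin d (T : Type) (V : porderType d) (A : set T) (f : T -> V) :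
  set T := [set x | A x /\ forall y, A y -> (f x <= f y)%O].

(* A cloud has at least one point, as its weights sum to 1. *)
Record cloud (R : realType) (n : nat) := Cloud {
  npts : nat;
  pt : 'I_npts -> 'rV[R]_n;
  wt : 'I_npts -> R;
  pt_inj : injective pt;
  wt_gt0 : forall i, 0 < wt i;
  wt_sum1 : \sum_i wt i = 1 }.
Arguments pt {R n} c i.
Arguments wt {R n} c i.

Section alignment.
Context (R : realType) (n : nat) (P Q : cloud R n).
Implicit Types (U : 'M[R]_n) (theta : 'rV[R]_n).
Implicit Types s : 'M[R]_(npts P, npts Q).

(* Transport plans between the projected measures are matrices indexed by the
   points of the clouds, so the set of plans depends neither on the rotation
   nor on the direction. *)
Definition transport_plans : set 'M[R]_(npts P, npts Q) :=
  [set s | [/\ forall i j, 0 <= s i j,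
               forall i, \sum_j s i j = wt P i &
               forall j, \sum_i s i j = wt Q j]].

Definition projected_cost U theta s : R :=
  \sum_i \sum_j
    s i j * ((pt P i *m U *m theta^T) 0 0 - (pt Q j *m theta^T) 0 0) ^+ 2.

(* The infimum is a minimum, by [optimal_plan_exists] and [optimal_costE]. *)
Definition optimal_cost U theta : R :=
  inf [set projected_cost U theta s | s in transport_plans].

Definition energy U : \bar R :=
  (\int[surface_measure]_(theta in sphere) (optimal_cost U theta)%:E)%E.

Definition plan_energy (sigma : 'rV[R]_n -> 'M[R]_(npts P, npts Q)) U :
  \bar R :=
  (\int[surface_measure]_(theta in sphere)
    (projected_cost U theta (sigma theta))%:E)%E.

Let sum_continuous (m : nat) (I : finType) (F : I -> 'rV[R]_m -> R) :
  (forall i, continuous (F i)) -> continuous (fun v => \sum_i F i v).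
Proof.
by move=> cF; apply: (@continuous_big _ _ _ _ xpredT) => // ; exact: add_continuous.
Qed.

Lemma optimal_plan_exists U theta :
  argmin transport_plans (projected_cost U theta) !=set0.
Proof.
pose K : set 'rV[R]_(npts P * npts Q) := vec_mx @^-1` transport_plans.
have centry i j :
    continuous (fun v : 'rV[R]_(npts P * npts Q) => vec_mx v i j : R).
  under eq_fun do rewrite mxE; exact: coord_continuous.
have clK : closed K.
  rewrite (_ : K =
    (\bigcap_i \bigcap_j [set v | 0 <= vec_mx v i j]) `&`
    ((\bigcap_i [set v | \sum_j vec_mx v i j = wt P i]) `&`
     (\bigcap_j [set v | \sum_i vec_mx v i j = wt Q j]))); last first.
    apply/seteqP; split => v /=.
      by move=> [s0 sP sQ]; split=> [i _ j _|]; [|split=> i _]; rewrite /=.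
    by move=> [s0 [sP sQ]]; split=> [i j|i|j];
      [exact: (s0 i I j I)|exact: (sP i I)|exact: (sQ j I)].
  apply: closedI; last apply: closedI.
  - apply: closed_bigI => i _; apply: closed_bigI => j _.
    exact: ((continuous_closedP _).1 (centry i j) _ (@closed_ge R 0)).
  - apply: closed_bigI => i _.
    exact: ((continuous_closedP _).1 (sum_continuous (centry i)) _ (@closed_eq R (wt P i))).
  - apply: closed_bigI => j _.
    exact: ((continuous_closedP _).1 (sum_continuous (centry^~ j)) _ (@closed_eq R (wt Q j))).
have cK : compact K.
  apply: (subclosed_compact clK
    (@rV_compact R _ (fun=> `[0, 1]%classic) (fun=> @segment_compact R 0 1))).
  move=> v [s0 sP sQ] k /=; rewrite in_itv/=.
  case/mxvec_indexP: k => i j.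
  have -> : v ord0 (mxvec_index i j) = vec_mx v i j by rewrite mxE.
  rewrite s0/= -(wt_sum1 P).
  rewrite (bigD1 i)//= -(sP i) (bigD1 j)//= -addrA lerDl addr_ge0// sumr_ge0//.
  by move=> l _; exact/ltW/wt_gt0.
have K0 : K !=set0.
  exists (mxvec (\matrix_(i, j) (wt P i * wt Q j))); rewrite /K/= mxvecK.
  split=> [i j|i|j].
  - by rewrite mxE mulr_ge0// ltW// wt_gt0.
  - by under eq_bigr do rewrite mxE; rewrite -mulr_sumr wt_sum1 mulr1.
  - by under eq_bigr do rewrite mxE; rewrite -mulr_suml wt_sum1 mul1r.
have cf : {within K, continuous (fun v => projected_cost U theta (vec_mx v))}.
  apply: continuous_subspaceT; apply: sum_continuous => i.
  apply: sum_continuous => j v; exact: (cvgM (centry i j v) (cvg_cst _)).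
have [v Kv vmin] := compact_EVT_min K0 cK cf.
exists (vec_mx v); split; first by move: Kv; rewrite inE.
move=> s Ts; rewrite -(mxvecK s); apply: vmin.
by rewrite inE /K/= mxvecK.
Qed.

Lemma optimal_costE U theta s :
  argmin transport_plans (projected_cost U theta) s ->
  optimal_cost U theta = projected_cost U theta s.
Proof.
move=> [Ts smin]; apply/eqP; rewrite eq_le; apply/andP; split.
  apply: ge_inf; last by exists s.
  by exists (projected_cost U theta s) => _ [s' Ts' <-]; exact: smin.
apply: lb_le_inf; first by exists (projected_cost U theta s), s.
by move=> _ [s' Ts' <-]; exact: smin.
Qed.

Record algorithm_run (U : nat -> 'M[R]_n)
    (sigma : nat -> 'rV[R]_n -> 'M[R]_(npts P, npts Q)) : Prop := AlgorithmRun {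
  init_orthogonal : orthogonal_group (U 0%N);
  init_plans : forall theta, sphere theta -> transport_plans (sigma 0%N theta);
  plans_measurable : forall k, measurable_fun sphere (sigma k);
  rotation_step : forall k, argmin orthogonal_group (plan_energy (sigma k)) (U k.+1);
  plan_step : forall k theta, sphere theta ->
    argmin transport_plans (projected_cost (U k.+1) theta) (sigma k.+1 theta) }.

End alignment.

(* Main.v *)
Require Import Defs.
From mathcomp Require Import all_boot all_order all_algebra.
From mathcomp Require Import all_classical all_reals all_analysis.
From mathcomp Require Import measurable_realfun.
Import Order.TTheory GRing.Theory Num.Theory.

Local Open Scope classical_set_scope.
Local Open Scope ring_scope.

(** The algorithm is an alternating minimisation of the single functional
    [plan_energy s U], in the orthogonal matrix [U] and in the family of plans
    [s], so its values decrease at each half step.  The energy [energy P Q U] is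
    what is left of this functional once the plans are optimal for [U]
    ([energy_optimal_plans]).  After the plans have been updated at least once,
    this gives
      energy (U k) = plan_energy (sigma k) (U k)
                  >= plan_energy (sigma k) (U k.+1)
                  >= plan_energy (sigma k.+1) (U k.+1) = energy (U k.+1):
    the first inequality is the minimality of [U k.+1], for which [U k] is a
    competitor, and the second is the minimality of [sigma k.+1 theta] in each
    direction theta, integrated over the sphere ([plan_energy_optimal_le]).
    The bound [1 <= k] is what makes the first equality available, the initial
    plans being arbitrary. *)

Lemma projected_cost_ge0 (R : realType) (n : nat) (P Q : cloud R n)
    (U : 'M[R]_n) (theta : 'rV[R]_n) (s : 'M[R]_(npts P, npts Q)) :
  transport_plans s -> 0 <= projected_cost U theta s.
Proof.
move=> [s0 _ _]; apply: sumr_ge0 => i _; apply: sumr_ge0 => j _.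
by rewrite mulr_ge0 ?sqr_ge0.
Qed.

Lemma measurable_projection (R : realType) (n : nat) (D : set 'rV[R]_n)
    (v : 'rV[R]_n) :
  measurable_fun D (fun theta : 'rV[R]_n => (v *m theta^T) 0 0).
Proof.
under eq_fun do rewrite mxE.
apply: measurable_sum => l.
under eq_fun do rewrite mxE.
apply: measurable_funM; first exact: measurable_cst.
exact: measurable_funTS (measurable_entry 0 l).
Qed.

Lemma measurable_projected_cost (R : realType) (n : nat) (P Q : cloud R n)
    (D : set 'rV[R]_n) (U : 'M[R]_n)
    (s : 'rV[R]_n -> 'M[R]_(npts P, npts Q)) :
  measurable_fun D s ->
  measurable_fun D (fun theta => projected_cost U theta (s theta)).
Proof.
move=> ms; apply: measurable_sum => i; apply: measurable_sum => j.
apply: measurable_funM; first exact: measurableT_comp (measurable_entry i j) ms.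
apply: measurable_funX.
by apply: measurable_funB; exact: measurable_projection.
Qed.

Lemma energy_optimal_plans (R : realType) (n : nat) (P Q : cloud R n)
    (U : 'M[R]_n) (s : 'rV[R]_n -> 'M[R]_(npts P, npts Q)) :
  (forall theta, sphere theta ->
    argmin (@transport_plans _ _ P Q) (projected_cost U theta) (s theta)) ->
  energy P Q U = plan_energy s U.
Proof.
move=> sopt; apply: eq_integral => theta; rewrite inE => Stheta.
by rewrite (optimal_costE (sopt _ Stheta)).
Qed.

(** The admissible plans are the same matrices for every [U], so plans [s] from
    an earlier step still compete with the ones that are optimal for [U]. *)
Lemma plan_energy_optimal_le (R : realType) (n : nat) (P Q : cloud R n)
    (U : 'M[R]_n) (s t : 'rV[R]_n -> 'M[R]_(npts P, npts Q)) :
  measurable_fun sphere s -> measurable_fun sphere t ->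
  (forall theta, sphere theta -> transport_plans (s theta)) ->
  (forall theta, sphere theta ->
    argmin (@transport_plans _ _ P Q) (projected_cost U theta) (t theta)) ->
  (plan_energy t U <= plan_energy s U)%E.
Proof.
move=> ms mt sadm topt; apply: ge0_le_integral.
- exact: measurable_sphere.
- move=> theta Stheta; rewrite lee_fin projected_cost_ge0//.
  exact: (topt _ Stheta).1.
- by apply/measurable_EFinP; exact: measurable_projected_cost.
- by apply/measurable_EFinP; exact: measurable_projected_cost.
- by move=> theta Stheta; rewrite lee_fin; apply: (topt _ Stheta).2; exact: sadm.
Qed.

Theorem theorem5 (R : realType) (n : nat) (n_gt0 : (0 < n)%N)
    (P Q : cloud R n) (U : nat -> 'M[R]_n)
    (sigma : nat -> 'rV[R]_n -> 'M[R]_(npts P, npts Q)) :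
  algorithm_run U sigma ->
  forall k : nat, (1 <= k)%N -> (energy P Q (U k.+1) <= energy P Q (U k))%E.
Proof.
move=> run [//|k] _.
rewrite (energy_optimal_plans _ _ _ _ _ _ (plan_step run k)).
rewrite (energy_optimal_plans _ _ _ _ _ _ (plan_step run k.+1)).
apply: (@le_trans _ _ (plan_energy (sigma k.+1) (U k.+2))).
  apply: plan_energy_optimal_le.
  - exact: plans_measurable run k.+1.
  - exact: plans_measurable run k.+2.
  - by move=> theta Stheta; exact: (plan_step run k Stheta).1.
  - exact: plan_step run k.+1.
exact: (rotation_step run k.+1).2 (rotation_step run k).1.
Qed.
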